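(* Let $x=us$ and $y=vt$ be pure quaternions, where $s=|x|$, $t=|y|$ and $u,v$ are pure unit quaternions. Suppose $s\ne t$. Then $$K_n(us,vt)=\rho_n(s,t)\,\frac{1-uv}{2}+(-1)^n\delta_n(s,t)\,\frac{1+uv}{2},$$ where $$\rho_n(s,t)=\frac{Q_n(s)Q_{n+1}(t)-Q_{n+1}(s)Q_n(t)}{h_n\,(t-s)},\qquad \delta_n(s,t)=\frac{Q_n(s)Q_{n+1}(t)+Q_{n+1}(s)Q_n(t)}{h_n\,(t+s)}.$$
   Context: $\mathbb{H}$ denotes the real quaternions; $\Lambda\subset\mathbb{H}$ is the set of pure (imaginary) quaternions $z=x_1\mathbf i+x_2\mathbf j+x_3\mathbf k$, identified with $\mathbb{R}^3$. The measure on $\Lambda$ is $d\mu(z)=(2\pi)^{-3/2}e^{-|z|^2/2}\,dm(z)$, with $m$ Lebesgue measure on $\mathbb{R}^3$. Polynomials are functions on $\Lambda$ of the form $P(z)=\sum_{k=0}^N z^ka_k$, $a_k\in\mathbb{H}$, with scalar product $\langle u,w\rangle=\int_\Lambda \overline{u(z)}w(z)\,d\mu(z)$. $P_n$ ($n\ge0$) denotes the (unique) system of monic polynomials (leading term $z^n$) with $\langle P_k,P_l\rangle=0$ for $k\ne l$, and $h_n=\langle P_n,P_n\rangle$. The polynomials $Q_n\in\mathbb{Z}[s]$ are determined by $P_n(us)=u^nQ_n(s)$ for every pure unit quaternion $u$ and real $s$. The kernel is $K_n(x,y)=\sum_{k=0}^{n}\dfrac{P_k(x)\overline{P_k(y)}}{h_k}$,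 $n\ge0$. *)

(* Defs.v *)
From HB Require Import structures.
From mathcomp Require Import all_boot all_order all_algebra.
From mathcomp Require Import all_classical all_reals all_analysis.
From mathcomp Require Import measurable_realfun.
From mathcomp Require Import ring.

Set Implicit Arguments.
Unset Strict Implicit.
Unset Printing Implicit Defensive.

Import Order.TTheory GRing.Theory Num.Theory.
Import numFieldNormedType.Exports.

Local Open Scope classical_set_scope.
Local Open Scope ring_scope.

(* The quaternion x0 + x1 i + x2 j + x3 k over R. *)
Record quat (R : Type) : Type :=
  Quat { qre : R; qi : R; qj : R; qk : R }.

Section QuatAlgebra.
Variable R : comNzRingType.
Implicit Types a b c : quat R.

Definition quat_tuple a : R * R * R * R := (qre a, qi a, qj a, qk a).
Definition tuple_quat (p : R * R * R * R) : quat R :=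
  Quat p.1.1.1 p.1.1.2 p.1.2 p.2.
Lemma quat_tupleK : cancel quat_tuple tuple_quat. Proof. by case. Qed.

HB.instance Definition _ := Choice.copy (quat R) (can_type quat_tupleK).

Definition quat_add a b :=
  Quat (qre a + qre b) (qi a + qi b) (qj a + qj b) (qk a + qk b).
Definition quat_opp a := Quat (- qre a) (- qi a) (- qj a) (- qk a).
Definition quat_mul a b := Quat
  (qre a * qre b - qi a * qi b - qj a * qj b - qk a * qk b)
  (qre a * qi b + qi a * qre b + qj a * qk b - qk a * qj b)
  (qre a * qj b - qi a * qk b + qj a * qre b + qk a * qi b)
  (qre a * qk b + qi a * qj b - qj a * qi b + qk a * qre b).
Definition quat_scale (r : R) a := Quat (r * qre a) (r * qi a) (r * qj a) (r * qk a).
Definition quat_zero : quat R := Quat 0 0 0 0.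
Definition quat_one : quat R := Quat 1 0 0 0.

Local Ltac quat_ring :=
  repeat case=> ? ? ? ?; rewrite /quat_add /quat_opp /quat_mul /quat_scale /quat_zero /quat_one /=;
  congr Quat; ring.

Lemma quat_addA : associative quat_add. Proof. quat_ring. Qed.
Lemma quat_addC : commutative quat_add. Proof. quat_ring. Qed.
Lemma quat_add0 : left_id quat_zero quat_add. Proof. quat_ring. Qed.
Lemma quat_addN : left_inverse quat_zero quat_opp quat_add. Proof. quat_ring. Qed.
HB.instance Definition _ :=
  GRing.isZmodule.Build (quat R) quat_addA quat_addC quat_add0 quat_addN.

Lemma quat_mulA : associative quat_mul. Proof. quat_ring. Qed.
Lemma quat_mul1q : left_id quat_one quat_mul. Proof. quat_ring. Qed.
Lemma quat_mulq1 : right_id quat_one quat_mul. Proof. quat_ring. Qed.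
Lemma quat_mulDl : left_distributive quat_mul quat_add. Proof. quat_ring. Qed.
Lemma quat_mulDr : right_distributive quat_mul quat_add. Proof. quat_ring. Qed.
Lemma quat_one_neq0 : quat_one != 0.
Proof. by apply/eqP => -[/eqP]; rewrite oner_eq0. Qed.
HB.instance Definition _ := GRing.Zmodule_isNzRing.Build (quat R)
  quat_mulA quat_mul1q quat_mulq1 quat_mulDl quat_mulDr quat_one_neq0.

Lemma quat_scaleA (r s : R) a : quat_scale r (quat_scale s a) = quat_scale (r * s) a.
Proof. by move: a; quat_ring. Qed.
Lemma quat_scale1 : left_id 1 quat_scale. Proof. quat_ring. Qed.
Lemma quat_scaleDr : right_distributive quat_scale quat_add.
Proof. by move=> r; quat_ring. Qed.
Lemma quat_scaleDl a : {morph quat_scale^~ a : r s / (r + s)%R >-> quat_add r s}.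
Proof. by move=> r s; move: a; quat_ring. Qed.
HB.instance Definition _ := GRing.Zmodule_isLmodule.Build R (quat R)
  quat_scaleA quat_scale1 quat_scaleDr quat_scaleDl.

Lemma quat_scaleAl (r : R) a b : quat_scale r (quat_mul a b) = quat_mul (quat_scale r a) b.
Proof. by move: a b; quat_ring. Qed.
HB.instance Definition _ := GRing.Lmodule_isLalgebra.Build R (quat R) quat_scaleAl.

Lemma quat_scaleAr (r : R) a b : quat_scale r (quat_mul a b) = quat_mul a (quat_scale r b).
Proof. by move: a b; quat_ring. Qed.
HB.instance Definition _ := GRing.Lalgebra_isAlgebra.Build R (quat R) quat_scaleAr.

Definition quat_conj a : quat R := Quat (qre a) (- qi a) (- qj a) (- qk a).

Definition quat_sqnorm a : R := qre a ^+ 2 + qi a ^+ 2 + qj a ^+ 2 + qk a ^+ 2.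

Lemma quat_mul_conj a : quat_conj a * a = (quat_sqnorm a)%:A.
Proof.
case: a => ? ? ? ?; rewrite /quat_sqnorm; congr Quat; rewrite /=; ring.
Qed.

Definition quat_pure a : Prop := qre a = 0.

(* The identification of R^3 with the pure quaternions. *)
Definition pure_of (z : R * R * R) : quat R := Quat 0 z.1.1 z.1.2 z.2.

(* [p] is read as sum_k z^k a_k, with the coefficients to the right of the
   powers of the variable, whereas [p.[z]] has them to the left. *)
Definition evalq (p : {poly quat R}) (z : quat R) : quat R :=
  \sum_(k < size p) z ^+ k * p`_k.

End QuatAlgebra.

Section GaussianProduct.
Variable R : realType.

Definition quat_norm (a : quat R) : R := Num.sqrt (quat_sqnorm a).

Definition pure_unit (u : quat R) : Prop := quat_pure u /\ quat_norm u = 1.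

Local Notation mR := (measurableTypeR R).
Local Notation leb := (@lebesgue_measure R).

Definition leb3 : {measure set (mR * mR * mR) -> \bar R} :=
  ((leb \x leb) \x leb)%E.

Definition gauss3_pdf (z : mR * mR * mR) : R :=
  (2 * pi) `^ (- (3 / 2)) * expR (- (quat_norm (pure_of z) ^+ 2 / 2)).

Definition gauss3 (A : set (mR * mR * mR)) : \bar R :=
  (\int[leb3]_(z in A) (gauss3_pdf z)%:E)%E.

Lemma gauss3_pdf_ge0 z : 0 <= gauss3_pdf z.
Proof. by rewrite mulr_ge0 ?powR_ge0 ?expR_ge0. Qed.

Lemma measurable_gauss3_pdf : measurable_fun setT gauss3_pdf.
Proof.
have m1 : measurable_fun setT (fun z : mR * mR * mR => z.1.1 : R).
  exact: (measurableT_comp measurable_fst measurable_fst).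
have m2 : measurable_fun setT (fun z : mR * mR * mR => z.1.2 : R).
  exact: (measurableT_comp measurable_snd measurable_fst).
have m3 : measurable_fun setT (fun z : mR * mR * mR => z.2 : R).
  exact: measurable_snd.
have E (z : mR * mR * mR) : quat_norm (pure_of z) ^+ 2 =
    (z.1.1 : R) ^+ 2 + (z.1.2 : R) ^+ 2 + (z.2 : R) ^+ 2.
  by rewrite sqr_sqrtr /quat_sqnorm /= ?expr0n ?add0r// ?addr_ge0 ?sqr_ge0.
apply: measurable_funM => //.
apply: (measurableT_comp (@measurable_expR R)).
apply: measurableT_comp => //.
apply: measurable_funM => //.
under eq_fun do rewrite E.
by apply: measurable_funD; [apply: measurable_funD|]; apply: measurable_funX.
Qed.

Let gauss30 : gauss3 set0 = 0%E.
Proof. by rewrite /gauss3 integral_set0. Qed.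

Let gauss3_ge0 A : (0 <= gauss3 A)%E.
Proof. by apply: integral_ge0 => z _; rewrite lee_fin gauss3_pdf_ge0. Qed.

Let gauss3_sigma_additive : semi_sigma_additive gauss3.
Proof.
apply: semi_sigma_additive_nng_induced => [|z].
  by apply/measurable_EFinP; exact: measurable_gauss3_pdf.
by rewrite lee_fin gauss3_pdf_ge0.
Qed.

HB.instance Definition _ := isMeasure.Build _ _ _
  gauss3 gauss30 gauss3_ge0 gauss3_sigma_additive.

(* Componentwise integral over the pure quaternions. *)
Definition integralq (f : quat R -> quat R) : quat R :=
  Quat (\int[gauss3]_(z in setT) qre (f (pure_of z)))
       (\int[gauss3]_(z in setT) qi (f (pure_of z)))
       (\int[gauss3]_(z in setT) qj (f (pure_of z)))
       (\int[gauss3]_(z in setT) qk (f (pure_of z))).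

Definition dotq (p q : {poly quat R}) : quat R :=
  integralq (fun z => quat_conj (evalq p z) * evalq q z).

(* The squared norm of [p] as a real number: the quaternion [dotq p p] is real,
   see [dotqq]. *)
Definition sqnorm_poly (p : {poly quat R}) : R := qre (dotq p p).

Lemma dotqq (p : {poly quat R}) : dotq p p = (sqnorm_poly p)%:A.
Proof.
have E z : quat_conj (evalq p z) * evalq p z = (quat_sqnorm (evalq p z))%:A.
  exact: quat_mul_conj.
have I0 (c : quat R -> R) : (forall r, c r%:A = 0) ->
    \int[gauss3]_(z in setT) c (quat_conj (evalq p (pure_of z)) *
      evalq p (pure_of z)) = 0.
  move=> c0; under eq_Rintegral do rewrite E c0.
  by rewrite Rintegral_cst// mul0r.
rewrite /sqnorm_poly; congr Quat; rewrite /= ?mulr1 ?mulr0//.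
- by apply: (I0 (@qi R)) => r; rewrite /= mulr0.
- by apply: (I0 (@qj R)) => r; rewrite /= mulr0.
- by apply: (I0 (@qk R)) => r; rewrite /= mulr0.
Qed.

Definition monic_orthogonal (P : nat -> {poly quat R}) : Prop :=
  (forall n, size (P n) = n.+1 /\ P n \is monic) /\
  (forall k l, k != l -> dotq (P k) (P l) = 0).

(* Value at the real [s] of a polynomial with integer coefficients. *)
Definition evalz (q : {poly int}) (s : R) : R := (map_poly intr q).[s].

Definition radial_part (P : nat -> {poly quat R}) (Q : nat -> {poly int}) :
    Prop :=
  forall n (u : quat R) (s : R), pure_unit u ->
    evalq (P n) (s *: u) = evalz (Q n) s *: u ^+ n.

Definition kernelq (P : nat -> {poly quat R}) (n : nat) (x y : quat R) :
    quat R :=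
  \sum_(k < n.+1) (sqnorm_poly (P k))^-1 *:
    (evalq (P k) x * quat_conj (evalq (P k) y)).

Definition rho P (Q : nat -> {poly int}) (n : nat) (s t : R) : R :=
  (evalz (Q n) s * evalz (Q n.+1) t - evalz (Q n.+1) s * evalz (Q n) t) /
  (sqnorm_poly (P n) * (t - s)).

Definition delta P (Q : nat -> {poly int}) (n : nat) (s t : R) : R :=
  (evalz (Q n) s * evalz (Q n.+1) t + evalz (Q n.+1) s * evalz (Q n) t) /
  (sqnorm_poly (P n) * (t + s)).

End GaussianProduct.

(* Main.v *)
From HB Require Import structures.
Require Import Defs.
From mathcomp Require Import all_boot all_order all_algebra.
From mathcomp Require Import all_classical all_reals all_analysis.
From mathcomp Require Import measurable_realfun.
From mathcomp Require Import ring lra.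

(** Multiplication by the variable is antisymmetric for the scalar product, so
    [z P_n = P_(n+1) + P_n a - P_(n-1) h_n / h_(n-1)] for some quaternion [a].
    Evaluating this at [us] and at [-us] forces the middle term to vanish, which
    leaves a real three-term recurrence for the [Q_n] and hence the classical
    Christoffel-Darboux formula.  Since [u^k conj(v^k)] is [1] for even [k] and
    [-uv] for odd [k], the kernel is
    [sum_k Q_k(s) Q_k(t) / h_k] times [(1 - uv)/2] plus
    [sum_k Q_k(-s) Q_k(t) / h_k] times [(1 + uv)/2]. *)

Set Implicit Arguments.
Unset Strict Implicit.
Unset Printing Implicit Defensive.

Import Order.TTheory GRing.Theory Num.Theory.
Import numFieldNormedType.Exports.
Local Open Scope ring_scope.

(** * Integration against a measure given by a density *)

Section Density.
Local Open Scope classical_set_scope.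
Local Open Scope ereal_scope.
Context d (T : measurableType d) (R : realType).
Variables mu nu : {measure set T -> \bar R}.
Variable g : T -> R.
Hypotheses (g0 : forall x, (0 <= g x)%R) (mg : measurable_fun setT g).
Hypothesis nuE : forall A, measurable A -> nu A = \int[mu]_(x in A) (g x)%:E.

Import HBNNSimple.

(** A simple function is a finite sum, over its values [y], of [y] times the indicator of [A y]; for
    a single indicator the claim is [nuE]. *)
Lemma integral_density_nnsfun (h : {nnsfun T >-> R}) :
  \int[nu]_x (h x)%:E = \int[mu]_x ((h x)%:E * (g x)%:E).
Proof.
pose A y := h @^-1` [set y].
have yA0 y x : 0 <= (y * \1_(A y) x)%:E :> \bar R by exact: nnfun_muleindic_ge0.
have mAy y : measurable (A y) by exact: measurable_sfunP.
have mA y : measurable_fun setT (fun x => (y * \1_(A y) x)%:E).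
  by apply/measurable_EFinP; apply: measurable_funM => //; exact: measurable_indic.
have hE x : (h x)%:E = \sum_(y \in range h) (y * \1_(A y) x)%:E.
  by rewrite (fimfunE h) -fsumEFin.
under eq_integral do rewrite hE.
under [RHS]eq_integral do rewrite hE ge0_mule_fsuml//.
rewrite !ge0_integral_fsum//; last 2 first.
- by move=> y; apply: emeasurable_funM => //; exact/measurable_EFinP.
- by move=> y x _; apply: mule_ge0; [exact: yA0|rewrite lee_fin].
apply: eq_fsbigr => y; rewrite inE => -[x0 _ hx0].
have y0 : (0 <= y)%R by rewrite -hx0.
under eq_integral do rewrite EFinM.
under [RHS]eq_integral do rewrite EFinM -muleA.
rewrite !ge0_integralZl//=.
- congr (_ * _); rewrite integral_indic// setIT nuE// integral_mkcond.
  apply: eq_integral => x _; rewrite patchE indicE.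
  by case: (x \in A y); rewrite ?mul1e ?mul0e.
- apply: emeasurable_funM; exact/measurable_EFinP.
- by move=> x _; rewrite mule_ge0 ?lee_fin.
- exact/measurable_EFinP.
Qed.

(** Monotone convergence applies on both sides: simple functions increase to [f] and, since [g] is
    nonnegative, their products with [g] increase to [f] times [g]. *)
Lemma ge0_integral_density (f : T -> \bar R) :
  (forall x, 0 <= f x) -> measurable_fun setT f ->
  \int[nu]_x f x = \int[mu]_x (f x * (g x)%:E).
Proof.
move=> f0 mf; pose h := nnsfun_approx measurableT mf.
have hf x : (h n x)%:E @[n --> \oo] --> f x by exact: cvg_nnsfun_approx.
have ndh x : nondecreasing_seq (fun n => (h n x)%:E).
  by move=> m n mn; rewrite lee_fin; exact/lefP/nd_nnsfun_approx.
have mh n : measurable_fun setT (fun x => (h n x)%:E) by exact/measurable_EFinP.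
have nu_cvg : \int[nu]_x (h n x)%:E @[n --> \oo] --> \int[nu]_x f x.
  rewrite (eq_integral (fun x => limn (fun n => (h n x)%:E))); last first.
    by move=> x _; apply/esym/cvg_lim.
  apply: cvg_monotone_convergence => // n x _.
  by rewrite lee_fin.
have mu_cvg : \int[mu]_x ((h n x)%:E * (g x)%:E) @[n --> \oo] -->
    \int[mu]_x (f x * (g x)%:E).
  rewrite (eq_integral (fun x => limn (fun n => (h n x)%:E * (g x)%:E))); last first.
    by move=> x _; apply/esym/cvg_lim => //; exact: cvgeZr.
  apply: cvg_monotone_convergence => //.
  - by move=> n; apply: emeasurable_funM => //; exact/measurable_EFinP.
  - by move=> n x _; rewrite mule_ge0 ?lee_fin.
  - by move=> x _ m n mn; rewrite lee_wpmul2r ?lee_fin// -lee_fin; exact: ndh.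
rewrite (funext (fun n => integral_density_nnsfun (h n))) in nu_cvg.
exact: cvg_unique nu_cvg mu_cvg.
Qed.

End Density.

(** * Tonelli's theorem for products of functions of separate variables *)

Section ProductIntegral.
Local Open Scope ereal_scope.
Context d1 d2 (T1 : measurableType d1) (T2 : measurableType d2) (R : realType).
Variables (m1 : {sigma_finite_measure set T1 -> \bar R})
          (m2 : {sigma_finite_measure set T2 -> \bar R}).

Lemma ge0_integral_prodM (f : T1 -> R) (g : T2 -> R) :
  (forall x, 0 <= f x)%R -> (forall x, 0 <= g x)%R ->
  measurable_fun setT f -> measurable_fun setT g ->
  \int[(m1 \x m2)%E]_z (f z.1 * g z.2)%:E =
  \int[m1]_x (f x)%:E * \int[m2]_y (g y)%:E.
Proof.
move=> f0 g0 mf mg; rewrite fubini_tonelli1; last 2 first.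
- apply/measurable_EFinP; apply: measurable_funM.
  + exact: measurableT_comp.
  + exact: measurableT_comp.
- by move=> z; rewrite lee_fin mulr_ge0.
rewrite -ge0_integralZr//=; first last.
- by apply: integral_ge0 => y _; rewrite lee_fin.
- by move=> x _; rewrite lee_fin.
- exact/measurable_EFinP.
apply: eq_integral => x _; rewrite /fubini_F /=.
under eq_integral do rewrite EFinM.
rewrite ge0_integralZl//=.
- exact/measurable_EFinP.
- by move=> y _; rewrite lee_fin.
- by rewrite lee_fin.
Qed.

End ProductIntegral.

(** * The Gaussian measure on three-dimensional space *)

Section Gauss3.
Local Open Scope classical_set_scope.
Variable R : realType.
Local Notation mR := (measurableTypeR R).
Local Notation leb := (@lebesgue_measure R).

(* A named copy of [leb \x leb], to carry the sigma-finite structure that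
   Fubini-Tonelli requires of its first factor. *)
Definition leb2 : set (mR * mR) -> \bar R := (leb \x leb)%E.

HB.instance Definition _ := Measure.on leb2.

Let sigma_finite_leb2 : sigma_finite setT leb2.
Proof.
have /sigma_finiteP[F [TF ndF Foo]] := sigma_finiteT leb.
(* Monotonicity of [F] puts both coordinates of a point into the [F] of the larger index, so the
   squares cover the plane. *)
exists (fun n => F n `*` F n) => [|n].
  apply/seteqP; split => // -[x y] _.
  have [i _ Fx] : (\bigcup_i F i) x by rewrite -TF.
  have [j _ Fy] : (\bigcup_i F i) y by rewrite -TF.
  exists (maxn i j) => //; split.
  - exact: (subsetPset _ _ (ndF _ _ (leq_maxl i j))).
  - exact: (subsetPset _ _ (ndF _ _ (leq_maxr i j))).
have [mF F_lty] := Foo n.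
split; first exact: measurableX.
by rewrite /leb2 product_measure1E// lte_mul_pinfty// ge0_fin_numE.
Qed.

HB.instance Definition _ :=
  Measure_isSigmaFinite.Build _ _ _ leb2 sigma_finite_leb2.

Lemma measurable_expR_sqr4 :
  measurable_fun setT (fun x : mR => expR (- ((x : R) ^+ 2 / 4))).
Proof.
apply: measurableT_comp => //; apply: measurableT_comp => //.
by apply: measurable_funM => //; exact: measurable_funX.
Qed.

(** Up to the factor [normal_peak], the integrand is the normal density of mean 0 and variance 2,
    whose integral is 1. *)
Lemma integral_expR_sqr4_lty :
  (\int[leb]_x (expR (- (x ^+ 2 / 4)))%:E < +oo)%E.
Proof.
have s0 : Num.sqrt (2 : R) != 0 by rewrite gt_eqF// sqrtr_gt0.
have p0 := normal_peak_gt0 s0.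
have E (x : R) : (expR (- (x ^+ 2 / 4)))%:E =
    ((normal_peak (Num.sqrt (2 : R)))^-1%:E * (normal_pdf 0 (Num.sqrt 2) x)%:E)%E.
  rewrite /normal_pdf (negbTE s0) -EFinM mulKf ?gt_eqF// /normal_fun subr0.
  by congr (expR _)%:E; rewrite sqr_sqrtr// mulr2n; field.
under eq_integral do rewrite E.
rewrite ge0_integralZl//=.
- by rewrite integral_normal_pdf mule1 ltry.
- by apply/measurable_EFinP; exact: measurable_normal_pdf.
- by move=> x _; rewrite lee_fin normal_pdf_ge0.
- by rewrite lee_fin invr_ge0 ltW.
Qed.

Definition sqn (z : mR * mR * mR) : R := quat_sqnorm (pure_of z).

Lemma sqnE z : sqn z = (z.1.1 : R) ^+ 2 + (z.1.2 : R) ^+ 2 + (z.2 : R) ^+ 2.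
Proof. by rewrite /sqn /quat_sqnorm /= expr0n add0r. Qed.

Lemma sqn_ge0 z : 0 <= sqn z.
Proof. by rewrite sqnE !addr_ge0 ?sqr_ge0. Qed.

Lemma measurable_sqn : measurable_fun setT sqn.
Proof.
have m1 : measurable_fun setT (fun z : mR * mR * mR => z.1.1 : R).
  exact: (measurableT_comp measurable_fst measurable_fst).
have m2 : measurable_fun setT (fun z : mR * mR * mR => z.1.2 : R).
  exact: (measurableT_comp measurable_snd measurable_fst).
have m3 : measurable_fun setT (fun z : mR * mR * mR => z.2 : R).
  exact: measurable_snd.
rewrite (funext sqnE).
by apply: measurable_funD; [apply: measurable_funD|]; apply: measurable_funX.
Qed.

Lemma gauss3_pdfE z :
  gauss3_pdf z = (2 * pi) `^ (- (3 / 2)) * expR (- (sqn z / 2)).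
Proof. by rewrite /gauss3_pdf /quat_norm sqr_sqrtr // sqn_ge0. Qed.

Lemma gauss3_pdf_gt0 (z : mR * mR * mR) : 0 < gauss3_pdf z.
Proof. by rewrite mulr_gt0 ?powR_gt0 ?expR_gt0// mulr_gt0 ?pi_gt0. Qed.

Lemma ge0_integral_gauss3 (f : mR * mR * mR -> \bar R) :
  (forall z, 0 <= f z)%E -> measurable_fun setT f ->
  (\int[@gauss3 R]_z f z = \int[@leb3 R]_z (f z * (gauss3_pdf z)%:E))%E.
Proof.
move=> f0 mf; apply: ge0_integral_density => //.
- exact: gauss3_pdf_ge0.
- exact: measurable_gauss3_pdf.
Qed.

Lemma measurable_expR_sqn4 : measurable_fun setT (fun z => expR (sqn z / 4)).
Proof.
apply: measurableT_comp => //; apply: measurable_funM => //.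
exact: measurable_sqn.
Qed.

(** Against the density, the exponent |z|^2/4 becomes -|z|^2/4, and the integral splits into three
    finite one-dimensional ones. This integrand later dominates every polynomial. *)
Lemma integral_gauss3_expR_lty :
  (\int[@gauss3 R]_z (expR (sqn z / 4))%:E < +oo)%E.
Proof.
rewrite ge0_integral_gauss3; last 2 first.
- by move=> z; rewrite lee_fin expR_ge0.
- by apply/measurable_EFinP; exact: measurable_expR_sqn4.
pose e (x : mR) := expR (- ((x : R) ^+ 2 / 4)).
have E z : ((expR (sqn z / 4))%:E * (gauss3_pdf z)%:E =
   ((2 * pi) `^ (- (3 / 2)))%:E * (e z.1.1 * e z.1.2 * e z.2)%:E)%E.
  rewrite -!EFinM gauss3_pdfE mulrCA; congr (_ * _)%:E.
  by rewrite /e -!expRD sqnE; congr expR; field.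
under eq_integral do rewrite E.
have e0 x : 0 <= e x by exact: expR_ge0.
have me : measurable_fun setT e := measurable_expR_sqr4.
have me2 : measurable_fun setT (fun z : mR * mR => e z.1 * e z.2).
  by apply: measurable_funM; exact: measurableT_comp.
have me3 : measurable_fun setT (fun z : mR * mR * mR => e z.1.1 * e z.1.2 * e z.2).
  apply: measurable_funM; last exact: measurableT_comp.
  by apply: measurable_funM; apply: measurableT_comp => //; apply: measurableT_comp.
rewrite ge0_integralZl//=; first last.
- by rewrite lee_fin powR_ge0.
- by move=> z _; rewrite lee_fin !mulr_ge0.
- exact/measurable_EFinP.
rewrite lte_mul_pinfty ?lee_fin ?powR_ge0//.
rewrite (@eq_measure_integral _ _ _ setT (leb2 \x leb)%E); last first.
  by move=> A mA _.
rewrite (ge0_integral_prodM leb2 leb (f := fun z => e z.1 * e z.2))//; last first.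
  by move=> z; rewrite mulr_ge0.
rewrite (@eq_measure_integral _ _ _ setT (leb \x leb)%E); last first.
  by move=> A mA _.
rewrite (ge0_integral_prodM leb leb)//.
have e_ge0 : (0 <= \int[leb]_x (e x)%:E)%E.
  by apply: integral_ge0 => x _; rewrite lee_fin.
have e_fin : (\int[leb]_x (e x)%:E)%E \is a fin_num.
  by rewrite ge0_fin_numE//; exact: integral_expR_sqr4_lty.
by rewrite -ge0_fin_numE ?mule_ge0// !fin_numM.
Qed.

Lemma integrable_gauss3 (f : mR * mR * mR -> R) (C : R) :
  measurable_fun setT f -> (forall z, `|f z| <= C * expR (sqn z / 4)) ->
  (@gauss3 R).-integrable setT (EFin \o f).
Proof.
move=> mf fC.
apply: (@le_integrable _ _ _ _ _ _ _ (fun z => (C%:E * (expR (sqn z / 4))%:E)%E)) => //.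
- exact/measurable_EFinP.
- move=> z _; rewrite /= lee_fin (le_trans (fC z))//.
  exact: ler_norm.
- apply: integrableZl => //; apply/integrableP; split.
    by apply/measurable_EFinP; exact: measurable_expR_sqn4.
  under eq_integral do rewrite gee0_abs ?lee_fin ?expR_ge0//.
  exact: integral_gauss3_expR_lty.
Qed.

Lemma leb3_box (M : R) : @leb3 R
  ((`[M, M + 1] `*` `[M, M + 1]) `*` `[M, M + 1]) = 1%E.
Proof.
have L : leb `[M, M + 1] = 1%E.
  by rewrite lebesgue_measure_itv/= lte_fin ltrDl ltr01 -EFinB addrAC subrr add0r.
have L2 : (leb \x leb)%E (`[M, M + 1] `*` `[M, M + 1]) = 1%E.
  by rewrite product_measure1E// -[RHS]mule1; congr (_ * _)%E; exact: L.
rewrite [LHS]product_measure1E//; last exact: measurableX.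
by rewrite -[RHS]mule1; congr (_ * _)%E; [exact: L2|exact: L].
Qed.

(** If the integral were zero, [f] times the density would vanish off a null set [N]. It is positive
    on a unit cube with corner [M], so [N] would contain a set of measure 1. *)
Lemma integral_gauss3_gt0 (f : mR * mR * mR -> R) (M : R) :
  measurable_fun setT f -> (forall z, 0 <= f z) ->
  (forall z, M <= z.1.1 -> M <= z.1.2 -> M <= z.2 -> 0 < f z) ->
  (0 < \int[@gauss3 R]_z (f z)%:E)%E.
Proof.
move=> mf f0 fM; rewrite lt_def integral_ge0 ?andbT; last first.
  by move=> z _; rewrite lee_fin.
apply/eqP; rewrite ge0_integral_gauss3; last 2 first.
- by move=> z; rewrite lee_fin.
- exact/measurable_EFinP.
rewrite (eq_integral (fun z => `|(f z * gauss3_pdf z)%:E|%E)); last first.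
  by move=> z _; rewrite gee0_abs ?EFinM// lee_fin mulr_ge0 ?gauss3_pdf_ge0.
move/ae_eq_integral_abs => /(_ measurableT) [].
  apply/measurable_EFinP; apply: measurable_funM => //.
  exact: measurable_gauss3_pdf.
move=> N [mN N0 fN].
pose B : set (mR * mR * mR) :=
  (`[M, M + 1] `*` `[M, M + 1]) `*` `[M, M + 1].
have : (@leb3 R B <= @leb3 R N)%E.
  apply: le_measure; rewrite ?inE//.
    by apply: measurableX => //; exact: measurableX.
  move=> [[a b] c]; rewrite /B /= !in_itv/=.
  move=> [[/andP[Ma _] /andP[Mb _]] /andP[Mc _]].
  apply: fN => /= /(_ I) [] /eqP; rewrite gt_eqF//.
  by rewrite mulr_gt0 ?gauss3_pdf_gt0 ?fM.
by rewrite [X in (X <= _)%E]leb3_box N0 lee_fin ler10.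
Qed.

End Gauss3.

(** * Quaternion identities and evaluation with coefficients on the right *)

Section QuatTheory.
Variable R : comNzRingType.
Implicit Types (a b c z : quat R) (p q : {poly quat R}).

Local Ltac quat_ring := repeat case=> ? ? ? ?; congr Quat; rewrite /=; ring.

Lemma quat_conjM a b : quat_conj (a * b) = quat_conj b * quat_conj a.
Proof. by move: a b; quat_ring. Qed.

Lemma quat_conjK : involutive (@quat_conj R).
Proof. by case=> ? ? ? ?; rewrite /quat_conj /= !opprK. Qed.

Lemma quat_conj_pure z : quat_pure z -> quat_conj z = - z.
Proof.
by case: z => ? ? ? ?; rewrite /quat_pure /= => ->; congr Quat; rewrite /= oppr0.
Qed.

Lemma quat_sqr_pure z : quat_pure z -> z * z = - (quat_sqnorm z)%:A.
Proof. by move=> z0; rewrite -[LHS]opprK -mulNr -(quat_conj_pure z0) quat_mul_conj. Qed.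

Lemma quat_sqnormM a b : quat_sqnorm (a * b) = quat_sqnorm a * quat_sqnorm b.
Proof. by case: a b => ? ? ? ? [? ? ? ?]; rewrite /quat_sqnorm /=; ring. Qed.

Lemma quat_sqnorm1 : quat_sqnorm (1 : quat R) = 1.
Proof. by rewrite /quat_sqnorm /=; ring. Qed.

Lemma quat_sqnormX a n : quat_sqnorm (a ^+ n) = quat_sqnorm a ^+ n.
Proof. by elim: n => [|n IH]; rewrite ?quat_sqnorm1// !exprS quat_sqnormM IH. Qed.

(** Coefficients beyond the size are zero; this gives polynomials of different sizes a common range
    of summation. *)
Lemma evalqE N p z : (size p <= N)%N -> evalq p z = \sum_(k < N) z ^+ k * p`_k.
Proof.
move=> pN; rewrite /evalq (big_ord_widen N (fun k => z ^+ k * p`_k))// big_mkcond.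
by apply: eq_bigr => k _; case: ltnP => // ?; rewrite nth_default ?mulr0.
Qed.

Lemma evalqD p q z : evalq (p + q) z = evalq p z + evalq q z.
Proof.
pose N := maxn (size p) (size q).
rewrite !(@evalqE N) ?leq_maxl ?leq_maxr ?size_polyD// -big_split.
by apply: eq_bigr => k _; rewrite coefD mulrDr.
Qed.

(** The constant must stand on the right, next to the coefficients: on the left it would have to
    commute with the powers of [z]. *)
Lemma evalqMC p c z : evalq (p * c%:P) z = evalq p z * c.
Proof.
pose N := maxn (size (p * c%:P)) (size p).
rewrite !(@evalqE N) ?leq_maxl ?leq_maxr// mulr_suml.
by apply: eq_bigr => k _; rewrite coefMC mulrA.
Qed.

Lemma evalqXM p z : evalq ('X * p) z = z * evalq p z.
Proof.
pose N := maxn (size ('X * p)) (size p).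
rewrite (@evalqE N.+1 ('X * p)) ?leqW ?leq_maxl// (@evalqE N p) ?leq_maxr//.
rewrite big_ord_recl coefXM mulr0 add0r mulr_sumr.
by apply: eq_bigr => k _; rewrite coefXM /= exprS mulrA.
Qed.

Lemma evalqXn n z : evalq 'X^n z = z ^+ n.
Proof.
elim: n => [|n IH]; last by rewrite !exprS evalqXM IH.
by rewrite !expr0 (@evalqE 1) ?size_poly1// big_ord1 coef1 mul1r.
Qed.

End QuatTheory.

(** * Growth of quaternionic polynomials *)

Section QuatOrder.
Variable R : realType.
Implicit Types (a b c z : quat R) (p q : {poly quat R}).

Lemma quat_sqnorm_ge0 a : 0 <= quat_sqnorm a.
Proof. by rewrite /quat_sqnorm !addr_ge0 ?sqr_ge0. Qed.

Lemma quat_sqnormN a : quat_sqnorm (- a) = quat_sqnorm a.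
Proof. by rewrite /quat_sqnorm /= !sqrrN. Qed.

(** By the parallelogram identity the two sides differ by the squared norm of [a - b]. *)
Lemma quat_sqnormD_le a b :
  quat_sqnorm (a + b) <= 2 * quat_sqnorm a + 2 * quat_sqnorm b.
Proof.
rewrite -subr_ge0; have -> : 2 * quat_sqnorm a + 2 * quat_sqnorm b -
    quat_sqnorm (a + b) = quat_sqnorm (a - b).
  by case: a b => ? ? ? ? [? ? ? ?]; rewrite /quat_sqnorm /=; ring.
exact: quat_sqnorm_ge0.
Qed.

Lemma quat_sqnormD_ge a b :
  quat_sqnorm a / 2 - quat_sqnorm b <= quat_sqnorm (a + b).
Proof. by have := quat_sqnormD_le (a + b) (- b); rewrite addrK quat_sqnormN; lra. Qed.

Definition quat_comp (i : 'I_4) a : R := [:: qre a; qi a; qj a; qk a]`_i.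

(** Each component is a signed sum of four products of coordinates, and each product is at most half
    a sum of two squares. *)
Lemma quat_comp_conjM_le a b (i : 'I_4) :
  `|quat_comp i (quat_conj a * b)| <= quat_sqnorm a + quat_sqnorm b.
Proof.
have M (x y : R) : - (x ^+ 2 + y ^+ 2) / 2 <= x * y <= (x ^+ 2 + y ^+ 2) / 2.
  by have := sqr_ge0 (x + y); have := sqr_ge0 (x - y); rewrite sqrrB sqrrD; lra.
rewrite ler_norml; case: a b => a0 a1 a2 a3 [b0 b1 b2 b3].
case: i => -[|[|[|[|//]]]] ?; rewrite /quat_comp /quat_sqnorm /=.
- by move: (M a0 b0) (M a1 b1) (M a2 b2) (M a3 b3); lra.
- by move: (M a0 b1) (M a1 b0) (M a2 b3) (M a3 b2); lra.
- by move: (M a0 b2) (M a1 b3) (M a2 b0) (M a3 b1); lra.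
- by move: (M a0 b3) (M a1 b2) (M a2 b1) (M a3 b0); lra.
Qed.

(** Induction on the number of terms, splitting off the top one. The base 1 + |z|^2 is at least 1,
    so lower powers are bounded by the [n]-th. *)
Lemma evalq_sqnorm_le p n : (size p <= n.+1)%N ->
  exists2 C : R, 0 <= C &
    forall z, quat_sqnorm (evalq p z) <= C * (1 + quat_sqnorm z) ^+ n.
Proof.
rewrite /evalq; elim: (size p) => [_|m IH mn].
  by exists 0 => // z; rewrite big_ord0 mul0r /quat_sqnorm /= expr0n !addr0.
have [C C0 HC] := IH (ltnW mn).
exists (2 * C + 2 * quat_sqnorm p`_m) => [|z].
  by rewrite addr_ge0 ?mulr_ge0 ?quat_sqnorm_ge0.
rewrite big_ord_recr /= (le_trans (quat_sqnormD_le _ _))//.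
rewrite [leRHS]mulrDl lerD//; first by rewrite -mulrA ler_pM2l ?HC.
rewrite -[leRHS]mulrA ler_pM2l// quat_sqnormM quat_sqnormX mulrC.
rewrite ler_wpM2l ?quat_sqnorm_ge0//.
have z0 := quat_sqnorm_ge0 z.
rewrite (le_trans (_ : _ <= (1 + quat_sqnorm z) ^+ m))//.
  by apply: lerXn2r; rewrite ?nnegrE; lra.
by rewrite ler_weXn2l ?lerDl.
Qed.

(** The leading term wins: the remainder [q] has lower degree, so its squared norm grows by one
    power of |z|^2 less. *)
Lemma evalq_monic_gt0 p : p \is monic ->
  exists M, forall z, M <= quat_sqnorm z -> 0 < quat_sqnorm (evalq p z).
Proof.
move=> pm; have sp : (0 < size p)%N by rewrite lt0n size_poly_eq0 monic_neq0.
case Ep : (size p) sp => [//|n] _.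
case: n Ep => [Ep|n Ep].
  exists 0 => z _; have /eqP := monicP pm; rewrite /lead_coef Ep /= => /eqP p0.
  by rewrite /evalq Ep big_ord1 p0 mul1r quat_sqnorm1.
pose q := p - 'X^(n.+1).
have sq : (size q <= n.+1)%N.
  apply/leq_sizeP => j; rewrite leq_eqVlt coefB coefXn => /predU1P[<-|nj].
    by have := monicP pm; rewrite /lead_coef Ep /= => ->; rewrite eqxx subrr.
  by rewrite nth_default ?Ep// gtn_eqF// subrr.
have [C C0 HC] := evalq_sqnorm_le sq.
(* With r = |z|^2, the 2 gives r >= 1, hence 1 + r <= 2r; the other summand makes r^(n+1)/2 exceed C
   (2r)^n. *)
exists (2 + C * 2 ^+ n.+1) => z zM.
have -> : evalq p z = z ^+ n.+1 + evalq q z.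
  by rewrite -evalqXn -evalqD /q addrC subrK.
apply: lt_le_trans (quat_sqnormD_ge _ _).
rewrite subr_gt0 (le_lt_trans (HC z))// quat_sqnormX.
set r := quat_sqnorm z in zM *.
have C2 : 0 <= C * 2 ^+ n.+1 by rewrite mulr_ge0 ?exprn_ge0.
have r1 : 1 <= r by lra.
have r0 : 0 < r by rewrite (lt_le_trans ltr01).
apply: (@le_lt_trans _ _ (C * (2 * r) ^+ n)).
  by apply: ler_wpM2l => //; apply: lerXn2r; rewrite ?nnegrE; lra.
rewrite exprMn mulrA exprS [ltRHS]mulrAC ltr_pM2r ?exprn_gt0//.
by rewrite exprS in zM; lra.
Qed.

End QuatOrder.

(** * Measurability, integrability and linearity of quaternion-valued integrals *)

Section DotTheory.
Local Open Scope classical_set_scope.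
Variable R : realType.
Implicit Types (a b c : quat R) (f g : quat R -> quat R) (p q : {poly quat R}).
Local Notation mR := (measurableTypeR R).
Local Notation mu := (@gauss3 R).

Lemma Rintegral_sum d (T : measurableType d) (nu : {measure set T -> \bar R})
    (I : Type) (s : seq I) (f : I -> T -> R) :
  (forall i, nu.-integrable setT (EFin \o f i)) ->
  \int[nu]_(x in setT) (\sum_(i <- s) f i x) =
  \sum_(i <- s) \int[nu]_(x in setT) f i x.
Proof.
move=> intf; apply: EFin_inj; rewrite -sumEFin.
rewrite /Rintegral fineK; last first.
  rewrite integrable_fin_num//.
  rewrite (_ : (fun x => _) = fun x => (\sum_(i <- s) (f i x)%:E)%E).
    by apply: integrable_sum => // i _; exact: intf.
  by apply/funext => x; rewrite -sumEFin.
under eq_integral do rewrite -sumEFin.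
rewrite integral_sum//; apply: eq_bigr => i _.
by rewrite fineK// integrable_fin_num//; exact: intf.
Qed.

Definition quat_basis (i : 'I_4) : quat R :=
  Quat (i == 0%N :> nat)%:R (i == 1%N :> nat)%:R (i == 2%N :> nat)%:R
       (i == 3%N :> nat)%:R.

Lemma quat_ext a b : (forall i, quat_comp i a = quat_comp i b) -> a = b.
Proof.
case: a b => a0 a1 a2 a3 [b0 b1 b2 b3] E.
by congr Quat; [exact: (E (@Ordinal 4 0 isT))|exact: (E (@Ordinal 4 1 isT))|
  exact: (E (@Ordinal 4 2 isT))|exact: (E (@Ordinal 4 3 isT))].
Qed.

Lemma quat_comp_is_linear i : linear (@quat_comp R i).
Proof. by case: i => -[|[|[|[|//]]]] ? r a b. Qed.
HB.instance Definition _ i :=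
  GRing.isLinear.Build R (quat R) R _ (@quat_comp R i) (quat_comp_is_linear i).

Lemma quat_basisE a : a = \sum_i quat_comp i a *: quat_basis i.
Proof.
rewrite 4!big_ord_recl big_ord0; case: a => a0 a1 a2 a3.
by congr Quat; rewrite /quat_comp /= /bump /=; ring.
Qed.

Definition measurable_quat d (T : measurableType d) (f : T -> quat R) :=
  forall i, measurable_fun setT (fun x => quat_comp i (f x)).

Lemma measurable_quat_cst d (T : measurableType d) c :
  measurable_quat (fun _ : T => c).
Proof. by move=> i; exact: measurable_cst. Qed.

Lemma measurable_quatD d (T : measurableType d) (f g : T -> quat R) :
  measurable_quat f -> measurable_quat g -> measurable_quat (fun x => f x + g x).
Proof.
move=> mf mg i; under eq_fun do rewrite raddfD.
by apply: measurable_funD; [exact: mf|exact: mg].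
Qed.

Lemma measurable_quatM d (T : measurableType d) (f g : T -> quat R) :
  measurable_quat f -> measurable_quat g -> measurable_quat (fun x => f x * g x).
Proof.
move=> mf mg; have [[f0 f1] [f2 f3]] :=
  ((mf (@Ordinal 4 0 isT), mf (@Ordinal 4 1 isT)), (mf (@Ordinal 4 2 isT), mf (@Ordinal 4 3 isT))).
have [[g0 g1] [g2 g3]] :=
  ((mg (@Ordinal 4 0 isT), mg (@Ordinal 4 1 isT)), (mg (@Ordinal 4 2 isT), mg (@Ordinal 4 3 isT))).
case=> -[|[|[|[|//]]]] ?; rewrite /quat_comp /=.
- by apply: measurable_funB; [apply: measurable_funB; [apply: measurable_funB|]|];
    apply: measurable_funM.
- by apply: measurable_funB; [apply: measurable_funD; [apply: measurable_funD|]|];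
    apply: measurable_funM.
- by apply: measurable_funD; [apply: measurable_funD; [apply: measurable_funB|]|];
    apply: measurable_funM.
- by apply: measurable_funD; [apply: measurable_funB; [apply: measurable_funD|]|];
    apply: measurable_funM.
Qed.

Lemma measurable_quat_conj d (T : measurableType d) (f : T -> quat R) :
  measurable_quat f -> measurable_quat (fun x => quat_conj (f x)).
Proof.
move=> mf; case=> -[|[|[|[|//]]]] ?; rewrite /quat_comp /=.
- exact: (mf (@Ordinal 4 0 isT)).
- apply: measurableT_comp => //; exact: (mf (@Ordinal 4 1 isT)).
- apply: measurableT_comp => //; exact: (mf (@Ordinal 4 2 isT)).
- apply: measurableT_comp => //; exact: (mf (@Ordinal 4 3 isT)).
Qed.

Lemma measurable_pure_of : measurable_quat (fun z : mR * mR * mR => pure_of z).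
Proof.
case=> -[|[|[|[|//]]]] ?; rewrite /quat_comp /=.
- exact: measurable_cst.
- exact: (measurableT_comp measurable_fst measurable_fst).
- exact: (measurableT_comp measurable_snd measurable_fst).
- exact: measurable_snd.
Qed.

Lemma measurable_evalq p :
  measurable_quat (fun z : mR * mR * mR => evalq p (pure_of z)).
Proof.
have mX k : measurable_quat (fun z : mR * mR * mR => pure_of z ^+ k).
  elim: k => [|k IH]; first exact: measurable_quat_cst.
  under eq_fun do rewrite exprS.
  by apply: measurable_quatM => //; exact: measurable_pure_of.
rewrite /evalq; elim: (size p) => [|n IH].
  by under eq_fun do rewrite big_ord0; exact: measurable_quat_cst.
under eq_fun do rewrite big_ord_recr /=.
by apply: measurable_quatD => //; exact: measurable_quatM.
Qed.

(** Put m = n + 1, which is nonzero. Then 1 + r <= 4m (1 + r/(4m)) <= 4m exp(r/(4m)), and the [m]-th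
    power of this yields the constant (4m)^m. *)
Lemma exprn_le_expR n : exists2 C : R, 0 <= C &
  forall r, 0 <= r -> (1 + r) ^+ n <= C * expR (r / 4).
Proof.
exists ((4 * n.+1%:R) ^+ n.+1) => [|r r0]; first by rewrite exprn_ge0.
have n0 : 0 < 4 * n.+1%:R :> R by rewrite mulr_gt0.
rewrite (le_trans (_ : _ <= (1 + r) ^+ n.+1))//.
  by rewrite ler_weXn2l ?lerDl.
have -> : r / 4 = n.+1%:R * (r / (4 * n.+1%:R)).
  have : n.+1%:R != 0 :> R by rewrite pnatr_eq0.
  by move: (n.+1%:R) => m m0; field.
rewrite expRM_natl -exprMn; apply: lerXn2r; rewrite ?nnegrE.
- by rewrite addr_ge0.
- by rewrite mulr_ge0 ?expR_ge0 ?ltW.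
apply: (@le_trans _ _ (4 * n.+1%:R * (1 + r / (4 * n.+1%:R)))); last first.
  by rewrite ler_pM2l ?expR_ge1Dx.
rewrite mulrDr mulr1 mulrCA divff ?gt_eqF// mulr1 lerD2r.
by rewrite -natrM ler1n.
Qed.

Definition quat_integrable (f : quat R -> quat R) := forall i,
  mu.-integrable setT (EFin \o (fun z : mR * mR * mR => quat_comp i (f (pure_of z)))).

(** Each component is at most |p(z)|^2 + |q(z)|^2, hence at most a polynomial in 1 + |z|^2, which a
    multiple of exp(|z|^2/4) dominates. *)
Lemma quat_integrable_conjM p q :
  quat_integrable (fun z => quat_conj (evalq p z) * evalq q z).
Proof.
move=> i.
have [C C0 HC] := evalq_sqnorm_le (leqnSn (size p)).
have [D D0 HD] := evalq_sqnorm_le (leqnSn (size q)).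
have [C' C'0 HC'] := exprn_le_expR (size p).
have [D' D'0 HD'] := exprn_le_expR (size q).
apply: (@integrable_gauss3 _ _ (C * C' + D * D')).
  apply: measurable_quatM; last exact: measurable_evalq.
  by apply: measurable_quat_conj; exact: measurable_evalq.
move=> z; rewrite (le_trans (quat_comp_conjM_le _ _ _))// mulrDl lerD//.
- by rewrite (le_trans (HC _))// -mulrA ler_wpM2l// HC' ?sqn_ge0.
- by rewrite (le_trans (HD _))// -mulrA ler_wpM2l// HD' ?sqn_ge0.
Qed.

Lemma quat_comp_integralq i f :
  quat_comp i (integralq f) =
  \int[mu]_(z in setT) quat_comp i (f (pure_of (z : mR * mR * mR))).
Proof. by case: i => -[|[|[|[|//]]]] ?. Qed.

Lemma eq_integralq f g : (forall z, f (pure_of z) = g (pure_of z)) ->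
  integralq f = integralq g.
Proof.
move=> fg; apply: quat_ext => i; rewrite !quat_comp_integralq.
by apply: eq_Rintegral => z _; rewrite fg.
Qed.

Lemma integralqD f g : quat_integrable f -> quat_integrable g ->
  integralq (fun z => f z + g z) = integralq f + integralq g.
Proof.
move=> intf intg; apply: quat_ext => i.
rewrite raddfD /= !quat_comp_integralq -RintegralD//.
by apply: eq_Rintegral => z _; rewrite raddfD.
Qed.

(** Every component of [L (f z)] is a fixed real combination of the four components of [f z]. The
    maps needed are right multiplication, conjugation and negation. *)
Lemma integralq_linear (L : quat R -> quat R) f : linear L -> quat_integrable f ->
  integralq (fun z => L (f z)) = L (integralq f).
Proof.
move=> linL intf; apply: quat_ext => i.
pose L' : {linear quat R -> quat R} := HB.pack L (GRing.isLinear.Build R _ _ _ L linL).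
rewrite -[L]/(L' : quat R -> quat R).
have E a : quat_comp i (L' a) =
    \sum_j quat_comp j a * quat_comp i (L' (quat_basis j)).
  rewrite {1}(quat_basisE a) !linear_sum; apply: eq_bigr => j _.
  by rewrite !linearZ.
rewrite E quat_comp_integralq; under eq_Rintegral do rewrite E.
rewrite Rintegral_sum => [|j]; last first.
  rewrite (_ : _ \o _ = (fun z => (quat_comp j (f (pure_of z)))%:E *
    (quat_comp i (L' (quat_basis j)))%:E)%E)//.
  by apply: integrableZr => //; exact: intf.
by apply: eq_bigr => j _; rewrite RintegralZr// quat_comp_integralq.
Qed.

End DotTheory.

(** * Orthogonality and the three-term recurrence *)

Section OrthogonalPolynomials.
Variable R : realType.
Implicit Types (a b c u : quat R) (p q : {poly quat R}).

Lemma dotqDr p q r : dotq p (q + r) = dotq p q + dotq p r.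
Proof.
rewrite /dotq -integralqD; try exact: quat_integrable_conjM.
by apply: eq_integralq => z; rewrite evalqD mulrDr.
Qed.

Lemma dotqMCr p q c : dotq p (q * c%:P) = dotq p q * c.
Proof.
rewrite /dotq -(@integralq_linear _ (fun a => a * c)).
- by apply: eq_integralq => z; rewrite evalqMC mulrA.
- by move=> r a b; rewrite mulrDl scalerAl.
- exact: quat_integrable_conjM.
Qed.

Lemma dotq0r p : dotq p 0 = 0.
Proof. by rewrite -(mul0r (0 : quat R)%:P) dotqMCr mulr0. Qed.

Lemma quat_conj_dotq p q : quat_conj (dotq p q) = dotq q p.
Proof.
rewrite /dotq -(@integralq_linear _ (@quat_conj R)).
- by apply: eq_integralq => z; rewrite quat_conjM quat_conjK.
- by move=> r a b; congr Quat; rewrite /= opprD mulrN.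
- exact: quat_integrable_conjM.
Qed.

(* Multiplication by the variable is antisymmetric because the integral runs
   over pure quaternions, where conjugation is negation. *)
Lemma dotqXM p q : dotq ('X * p) q = - dotq p ('X * q).
Proof.
rewrite /dotq -(@integralq_linear _ (fun a => - a)).
- apply: eq_integralq => z; rewrite !evalqXM quat_conjM [quat_conj (pure_of z)]quat_conj_pure//.
  by rewrite mulrN mulNr mulrA.
- by move=> r a b; rewrite opprD scalerN.
- exact: quat_integrable_conjM.
Qed.

(** The integrand is |p(z)|^2, which is positive for large |z| because [p] is monic. *)
Lemma sqnorm_poly_gt0 p : p \is monic -> 0 < sqnorm_poly p.
Proof.
move=> /evalq_monic_gt0[M HM].
pose f (z : measurableTypeR R * measurableTypeR R * measurableTypeR R) :=
  quat_sqnorm (evalq p (pure_of z)).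
have fE z : qre (quat_conj (evalq p (pure_of z)) * evalq p (pure_of z)) = f z.
  by rewrite quat_mul_conj /= mulr1.
have -> : sqnorm_poly p = fine (\int[@gauss3 R]_z (f z)%:E)%E.
  by congr fine; apply: eq_integral => z _; rewrite -fE.
have intf : (@gauss3 R).-integrable setT (EFin \o f).
  apply: eq_integrable (quat_integrable_conjM p p (@Ordinal 4 0 isT)) => //.
  by move=> z _; rewrite /= -fE.
rewrite fine_gt0//; apply/andP; split; last first.
  have /integrableP[_] := intf.
  by under eq_integral do rewrite /= ger0_norm ?quat_sqnorm_ge0//.
(* A coordinate that is at least 1 and at least [M] has its square at least [M], so |z|^2 >= M. *)
apply: (@integral_gauss3_gt0 _ _ (Num.max 1 M)).
- by apply/measurable_EFinP; case/integrableP: intf.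
- by move=> z; exact: quat_sqnorm_ge0.
move=> z z1 z2 z3; apply: HM; rewrite -/(sqn z) sqnE.
move: z1 z2 z3; rewrite !ge_max => /andP[z1 Mz1] /andP[z2 _] /andP[z3 _].
by nra.
Qed.

Variable P : nat -> {poly quat R}.
Hypothesis hP : monic_orthogonal P.

Let h k := sqnorm_poly (P k).

Let h_gt0 k : 0 < h k. Proof. by apply: sqnorm_poly_gt0; case: hP => /(_ k)[]. Qed.

Let size_P k : size (P k) = k.+1. Proof. by case: hP => /(_ k)[]. Qed.

Let coef_P k : (P k)`_k = 1.
Proof. by have [_ /monicP] := hP.1 k; rewrite /lead_coef size_P. Qed.

Let size_reduce q m : (size q <= m.+1)%N -> (size (q - P m * (q`_m)%:P)%R <= m)%N.
Proof.
move=> sq; apply/leq_sizeP => j; rewrite leq_eqVlt coefB coefMC => /predU1P[<-|mj].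
  by rewrite coef_P mul1r subrr.
by rewrite (nth_default _ (leq_trans sq mj)) nth_default ?size_P// mul0r subrr.
Qed.

Let size_XP n : (size ('X * P n - P n.+1)%R <= n.+1)%N.
Proof.
apply/leq_sizeP => j; rewrite leq_eqVlt coefB coefXM => /predU1P[<-|nj].
  by rewrite /= !coef_P subrr.
by case: j nj => // j nj; rewrite /= !nth_default ?subrr ?size_P.
Qed.

(** Subtracting right multiples of the monic [P m] strips [q] of its top coefficients one by one,
    and each multiple is orthogonal to [P n]. *)
Lemma dotq_lower m n q : (m <= n)%N -> (size q <= m)%N -> dotq (P n) q = 0.
Proof.
elim: m q => [|m IH] q mn.
  by rewrite leqn0 size_poly_eq0 => /eqP->; exact: dotq0r.
move=> sq; rewrite -(subrK (P m * (q`_m)%:P) q) dotqDr IH ?size_reduce ?(ltnW mn)//.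
by rewrite dotqMCr hP.2 ?gtn_eqF// mul0r addr0.
Qed.

(** Pairing with [P m] isolates the coefficient of degree [m], multiplied by the positive [h m]; it
    vanishes, and the size drops. *)
Lemma orthogonal_eq0 m q : (size q <= m)%N ->
  (forall k, (k < m)%N -> dotq (P k) q = 0) -> q = 0.
Proof.
elim: m q => [|m IH] q; first by rewrite leqn0 size_poly_eq0 => /eqP.
move=> sq Hq; apply: IH => [|k km]; last by rewrite Hq// ltnW.
suff qm : q`_m = 0 by have := size_reduce sq; rewrite qm mulr0 subr0.
have := Hq m (ltnSn m).
rewrite -{1}(subrK (P m * (q`_m)%:P) q) dotqDr (@dotq_lower m)// ?size_reduce//.
rewrite add0r dotqMCr dotqq -scalerAl mul1r => /eqP.
by rewrite scaler_eq0 gt_eqF ?h_gt0//= => /eqP.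
Qed.

Lemma mulXP0 : exists a, 'X * P 0 = P 1 + P 0 * a%:P.
Proof.
exists (('X * P 0 - P 1)`_0).
have := size_reduce (size_XP 0); rewrite leqn0 size_poly_eq0 subr_eq0 => /eqP<-.
by rewrite addrC subrK.
Qed.

Lemma mulXP n : exists a,
  'X * P n.+1 = P n.+2 + P n.+1 * a%:P - P n * ((h n.+1 / h n)%:A)%:P.
Proof.
(* After the monic leading term, two reductions remove degrees [n.+1] and [n]; it remains to find
   [r] and [b]. *)
have [a [b [r [sr Er]]]] : exists a b (r : {poly quat R}), (size r <= n)%N /\
    'X * P n.+1 = P n.+2 + P n.+1 * a%:P + P n * b%:P + r.
  pose r0 := 'X * P n.+1 - P n.+2; pose r1 := r0 - P n.+1 * (r0`_n.+1)%:P.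
  exists (r0`_n.+1), (r1`_n), (r1 - P n * (r1`_n)%:P).
  split; first by do 2 apply: size_reduce; exact: size_XP.
  have V (x y c d : {poly quat R}) : x = y + c + d + (x - y - c - d).
    by rewrite -!addrA -!opprD !addrA [y + c + d + x]addrC addrK.
  exact: V.
have dotE k : (k <= n)%N -> dotq (P k) ('X * P n.+1) =
    dotq (P k) (P n) * b + dotq (P k) r.
  have D p x y z w : dotq p (x + y * a%:P + z * b%:P + w) =
      dotq p x + dotq p y * a + dotq p z * b + dotq p w.
    by rewrite 3!dotqDr; congr (_ + _ + _ + _); exact: dotqMCr.
  move=> kn; rewrite Er D.
  rewrite (hP.2 k n.+2) ?ltn_eqF ?ltnS ?(leqW kn)//.
  rewrite (hP.2 k n.+1) ?ltn_eqF ?ltnS//.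
  by rewrite mul0r !add0r.
(* Antisymmetry moves the variable onto [P k], whose degree is under control. *)
have dotXP k : dotq (P k) ('X * P n.+1) = - quat_conj (dotq (P n.+1) ('X * P k)).
  by rewrite quat_conj_dotq dotqXM opprK.
(* For k < n, the size of ['X * P k] is at most [k.+2], hence at most [n.+1], so its pairing with
   [P n.+1] vanishes; thus [r] is orthogonal to each such [P k]. *)
have r0 : r = 0.
  apply: (orthogonal_eq0 sr) => k kn.
  have := dotE k (ltnW kn); rewrite dotXP (@dotq_lower k.+2)//; last first.
    by rewrite (leq_trans (size_polyMleq _ _))// size_P size_polyX.
  by rewrite hP.2 ?ltn_eqF// mul0r add0r => <-; congr Quat; rewrite /= !oppr0.
suff bE : b = - (h n.+1 / h n)%:A.
  exists a; rewrite Er r0 [LHS]addr0 bE; congr (_ + _).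
  by rewrite -[RHS]mulrN; congr (_ * _); exact: polyCN.
(* For k = n, ['X * P n] is [P n.+1] plus a polynomial of size at most [n.+1], so the pairing is
   [h n.+1] and [b] times [h n] is its negative. *)
have := dotE n (leqnn n); rewrite r0 dotq0r addr0 dotXP dotqq.
rewrite -(subrK (P n.+1) ('X * P n)) dotqDr (@dotq_lower n.+1)// add0r dotqq.
rewrite -scalerAl mul1r -/(h n) -/(h n.+1) => E.
have hn : h n != 0 by rewrite gt_eqF.
apply: (scalerI hn); rewrite -E scalerN scalerA mulrC divfK//.
by congr Quat; rewrite /= ?mulr0 ?oppr0 ?opprK ?mulr1.
Qed.

End OrthogonalPolynomials.

(** * The scalar Christoffel-Darboux formula *)

Lemma christoffel_darboux (F : fieldType) (q : nat -> F -> F) (h : nat -> F) :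
  (forall k, h k != 0) -> (forall s, q 1 s = s * q 0 s) ->
  (forall k s, q k.+2 s = s * q k.+1 s - h k.+1 / h k * q k s) ->
  forall n s t, (\sum_(k < n.+1) q k s * q k t / h k) * (t - s) =
    (q n s * q n.+1 t - q n.+1 s * q n t) / h n.
Proof.
move=> h0 q1 qS n s t; elim: n => [|n IH].
  by rewrite big_ord1 !q1; ring.
(* In the expanded right side, the terms with factors [t] and [s] give the new summand, and those
   with [h n.+1 / h n] give the induction hypothesis. *)
rewrite big_ord_recr /= mulrDl IH !qS.
by field; rewrite !h0.
Qed.

(** * Powers of pure unit quaternions *)

Section PureUnits.
Variable R : realType.
Implicit Types (a b u v : quat R).

Lemma pure_unit_sqnorm u : pure_unit u -> quat_sqnorm u = 1.
Proof.
by move=> [_ u1]; rewrite -(sqr_sqrtr (quat_sqnorm_ge0 u)) -/(quat_norm u) u1 expr1n.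
Qed.

Lemma pure_unit_sqr u : pure_unit u -> u * u = -1.
Proof. by move=> hu; rewrite (quat_sqr_pure hu.1) pure_unit_sqnorm// scale1r. Qed.

Lemma pure_unitN u : pure_unit u -> pure_unit (- u).
Proof.
case=> u0 u1; split; first by rewrite /quat_pure /= u0 oppr0.
by rewrite /quat_norm quat_sqnormN.
Qed.

Lemma pure_unit_i : pure_unit (Quat 0 1 0 0 : quat R).
Proof.
by split => //; rewrite /quat_norm /quat_sqnorm /= !expr0n expr1n /= !addr0 add0r sqrtr1.
Qed.

Lemma pure_unitX_neq0 u n : pure_unit u -> u ^+ n != 0.
Proof.
move=> hu; apply/eqP => un0; have := quat_sqnormX u n.
rewrite un0 (pure_unit_sqnorm hu) expr1n /quat_sqnorm /= expr0n !addr0.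
by move/esym/eqP; rewrite oner_eq0.
Qed.

(* Replacing u by -u changes the sign of exactly one side. *)
Lemma pure_unit_parity (A : R) b n :
  (forall u, pure_unit u -> A *: u ^+ n = u ^+ n.+1 * b) -> A = 0.
Proof.
have hi := pure_unit_i; set i : quat R := Quat 0 1 0 0 in hi => H.
have NX k : (- i) ^+ k = (-1) ^+ k *: i ^+ k by rewrite -scaleN1r exprZn.
have := H _ (pure_unitN hi).
rewrite !NX -[RHS]scalerAl -(H _ hi) !scalerA => /eqP.
rewrite -subr_eq0 -scalerBl scaler_eq0 (negbTE (pure_unitX_neq0 n hi)) orbF.
rewrite exprS mulN1r mulNr opprK mulrC -mulr2n mulrn_eq0 /= mulf_eq0.
by rewrite signr_eq0 => /eqP.
Qed.

(** The left side has period 2 in [k], with values 1 and -uv, which are the sum and the difference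
    of (1 - uv)/2 and (1 + uv)/2. *)
Lemma pure_unitX_conj u v k : pure_unit u -> pure_unit v ->
  u ^+ k * quat_conj (v ^+ k) =
  2^-1 *: (1 - u * v) + (-1) ^+ k *: (2^-1 *: (1 + u * v)).
Proof.
move=> hu hv.
have half b : 2^-1 *: (b + b) = b :> quat R.
  by rewrite scalerDr -scalerDl (_ : 2^-1 + 2^-1 = 1 :> R);
    [rewrite scale1r|lra].
have conj1 : quat_conj 1 = 1 :> quat R by congr Quat; rewrite /= oppr0.
have conjv : quat_conj v = - v by apply: quat_conj_pure hv.1.
have SS j : u ^+ j.+2 * quat_conj (v ^+ j.+2) = u ^+ j * quat_conj (v ^+ j).
  rewrite !exprSr !quat_conjM conjv -!mulrA (mulrA u u) pure_unit_sqr//.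
  rewrite (mulrA (- v) (- v)) mulrNN (pure_unit_sqr hv).
  by rewrite !mulN1r opprK.
have -> : u ^+ k * quat_conj (v ^+ k) = if odd k then - (u * v) else 1.
  rewrite -{1 2}(odd_double_half k); elim: k./2 => [|m IH].
    rewrite addn0; case: (odd k); last by rewrite !expr0 conj1 mulr1.
    by rewrite !expr1 conjv mulrN.
  by rewrite doubleS !addnS SS.
rewrite -signr_odd; case: (odd k); rewrite ?expr1 ?expr0 ?scale1r ?scaleN1r.
- by rewrite -scalerBr opprD addrACA subrr add0r half.
- by rewrite -scalerDr addrACA addNr addr0 half.
Qed.

End PureUnits.

(** * The real recurrence for the radial parts *)

Section RadialPart.
Variable R : realType.
Variables (P : nat -> {poly quat R}) (Q : nat -> {poly int}).
Hypotheses (hP : monic_orthogonal P) (hQ : radial_part P Q).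

Let h k := sqnorm_poly (P k).

(** The point (-s)i is also s(-i); compare the two evaluations of [P k] there and cancel the nonzero
    power of i. *)
Lemma evalz_parity k (s : R) : evalz (Q k) (- s) = (-1) ^+ k * evalz (Q k) s.
Proof.
have hi := pure_unit_i R; set i : quat R := Quat 0 1 0 0 in hi.
have := hQ k (- s) hi; rewrite scaleNr -scalerN hQ; last exact: pure_unitN.
have -> : (- i) ^+ k = (-1) ^+ k *: i ^+ k.
  by rewrite -scaleN1r exprZn.
rewrite scalerA => /eqP; rewrite -subr_eq0 -scalerBl scaler_eq0.
by rewrite (negbTE (pure_unitX_neq0 k hi)) orbF subr_eq0 mulrC => /eqP.
Qed.

Lemma evalz1 (s : R) : evalz (Q 1) s = s * evalz (Q 0) s.
Proof.
have [a aE] := mulXP0 hP.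
apply/eqP; rewrite -subr_eq0; apply/eqP.
apply: (@pure_unit_parity _ _ (evalz (Q 0) s *: a) 0) => u hu.
have := congr1 (fun p => evalq p (s *: u)) aE.
rewrite evalqXM evalqD evalqMC !hQ// expr0 expr1 -!scalerAl -scalerAr.
rewrite mulr1 mul1r scalerA => E.
have -> : evalz (Q 0) s *: a = (s * evalz (Q 0) s - evalz (Q 1) s) *: u.
  by rewrite scalerBl E addrAC subrr add0r.
by rewrite -scalerAr pure_unit_sqr// scalerN -scaleNr opprB.
Qed.

(** At [s *: u], since u^(n+2) = -u^n, all terms of [mulXP] are real multiples of u^n except the one
    with [a], which carries u^(n+1). Parity in [u] makes the real factor vanish. *)
Lemma evalz_rec n (s : R) :
  evalz (Q n.+2) s = s * evalz (Q n.+1) s - h n.+1 / h n * evalz (Q n) s.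
Proof.
have [a aE] := mulXP hP n.
apply/eqP; rewrite -subr_eq0; apply/eqP.
apply: (@pure_unit_parity _ _ (evalz (Q n.+1) s *: a) n) => u hu.
have uu : u ^+ n.+2 = - u ^+ n by rewrite !exprS mulrA pure_unit_sqr// mulN1r.
have D p q r c z : evalq (p + q * a%:P - r * c%:P) z =
    evalq p z + evalq q z * a - evalq r z * c.
  rewrite 2!evalqD; congr (_ + _ + _); first exact: evalqMC.
  by rewrite -[RHS]mulrN -evalqMC; congr (evalq _ z); rewrite polyCN mulrN.
have E := congr1 (fun p => evalq p (s *: u)) aE.
rewrite evalqXM D !hQ// uu in E.
rewrite -!scalerAl -!scalerAr -exprS uu mulr1 !scalerA in E.
transitivity ((s * evalz (Q n.+1) s) *: (- u ^+ n) +
  (evalz (Q n) s * (h n.+1 / h n)) *: u ^+ n - evalz (Q n.+2) s *: (- u ^+ n)).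
  by rewrite !scalerN opprK -scaleNr -!scalerDl; congr (_ *: _); ring.
by rewrite E subrK addrAC subrr add0r scalerAr.
Qed.

End RadialPart.


(** * Assembling the kernel from two real Christoffel-Darboux sums *)

Theorem mainTheorem9 (R : realType)
    (P : nat -> {poly quat R}) (hP : monic_orthogonal P)
    (Q : nat -> {poly int}) (hQ : radial_part P Q)
    (n : nat) (x y u v : quat R) (s t : R)
    (hu : pure_unit u) (hv : pure_unit v)
    (hx : x = s *: u) (hy : y = t *: v)
    (hs : s = quat_norm x) (ht : t = quat_norm y)
    (hst : s != t) :
  kernelq P n (s *: u) (t *: v) =
    rho P Q n s t *: (2^-1 *: (1 - u * v)) +
    ((-1) ^+ n * delta P Q n s t) *: (2^-1 *: (1 + u * v)).
Proof.
have h0 k : sqnorm_poly (P k) != 0.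
  by rewrite gt_eqF// sqnorm_poly_gt0//; case: hP => /(_ k)[].
have s0 : 0 <= s by rewrite hs sqrtr_ge0.
have t0 : 0 <= t by rewrite ht sqrtr_ge0.
have ts : t - s != 0 by rewrite subr_eq0 eq_sym.
(* Both are nonnegative, so a zero sum would make both zero and hence equal. *)
have ts' : t + s != 0.
  rewrite paddr_eq0//; apply/negP => /andP[/eqP t1 /eqP s1].
  by move: hst; rewrite t1 s1 eqxx.
have CD := christoffel_darboux h0 (evalz1 hP hQ) (evalz_rec hP hQ) n.
have -> : rho P Q n s t =
    \sum_(k < n.+1) evalz (Q k) s * evalz (Q k) t / sqnorm_poly (P k).
  by apply: (mulIf ts); rewrite CD /rho invfM -!mulrA mulVf// mulr1.
(* This is the same formula at [- s]: the parities of [Q n] and [Q n.+1] differ, which turns the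
   minus sign of the numerator into a plus and leaves (-1)^n. *)
have -> : (-1) ^+ n * delta P Q n s t =
    \sum_(k < n.+1) evalz (Q k) (- s) * evalz (Q k) t / sqnorm_poly (P k).
  apply: (mulIf ts'); have := CD (- s) t; rewrite opprK => ->.
  rewrite !(evalz_parity hQ) /delta invfM -!mulrA mulVf// mulr1 exprS.
  by ring.
(* The sums now agree term by term: the sign (-1)^k from [pure_unitX_conj] is the one that [- s]
   brings out of [Q k]. *)
rewrite /kernelq 2!scaler_suml -big_split; apply: eq_bigr => k _ /=.
rewrite !hQ// (evalz_parity hQ).
have conjZ (r : R) a : quat_conj (r *: a) = r *: quat_conj a.
  by congr Quat; rewrite /= mulrN.
rewrite conjZ -[in LHS]scalerAl -[in LHS]scalerAr pure_unitX_conj//.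
move: (2^-1 *: (1 - u * v)) (2^-1 *: (1 + u * v)) => A B.
by rewrite !scalerA scalerDr !scalerA; congr (_ *: _ + _ *: _); ring.
Qed.
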